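(* Let $g$ be a kernel metric on $\mathrm{SPD}(n)$ with kernel function $\phi$. Then the cometric $g^*$, seen as a metric on $\mathrm{SPD}(n)$ through the identification of $T_\Sigma\mathrm{SPD}(n)$ with $T^*_\Sigma\mathrm{SPD}(n)$ given by the Frobenius inner product, is a kernel metric with kernel function $\phi^*=1/\phi$.
   Context: $\mathrm{SPD}(n)$ is the manifold of real symmetric positive definite $n\times n$ matrices, an open subset of the space $\mathrm{Sym}(n)$ of symmetric matrices; $T_\Sigma\mathrm{SPD}(n)$ is identified with $\mathrm{Sym}(n)$. A kernel metric is an $\mathrm{O}(n)$-invariant Riemannian metric $g$ for which there is a smooth symmetric map $\phi:(0,\infty)^2\to(0,\infty)$ (the kernel function) such that $g_\Sigma(X,X)=\sum_{i,j}\frac{1}{\phi(d_i,d_j)}X_{ij}'^2$, where $\Sigma=PDP^\top$ with $P\in\mathrm{O}(n)$, $D=\mathrm{Diag}(d_1,\dots,d_n)$, and $X=PX'P^\top$. A Riemannian metric $g$ on a manifold $\mathcal{M}$ defines the cometric $g^*$ on $T^*\mathcal{M}$: for covectors $\omega,\omega'$ at a point, $g^*(\omega,\omega')=\omega(x')$ where $x'$ is the unique tangent vector such that $g(x,x')=\omega'(x)$ for all tangent vectors $x$. On $\mathrm{SPD}(n)$ the tangent and cotangent spaces at $\Sigma$ are identified by $X\in\mathrm{Sym}(n)\mapsto\big(Y\mapsto\mathrm{tr}(XY)\big)\in T^*_\Sigma\mathrm{SPD}(n)$, so a cometric can be seen as a metric. *)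

(* Defs.v *)
From mathcomp Require Import all_boot all_order all_algebra.
From mathcomp Require Import all_classical all_reals all_analysis.

Set Implicit Arguments.
Unset Strict Implicit.
Unset Printing Implicit Defensive.

Import Order.TTheory GRing.Theory Num.Theory.
Import numFieldNormedType.Exports.

Local Open Scope classical_set_scope.
Local Open Scope ring_scope.

(* C^k regularity on U, a relatively open subset of the linear subspace V of W:
   the iterated directional derivatives of order at most k, in directions of V,
   exist on U and are continuous for the topology of U. For x in U and v in V,
   x + h v stays in U for small h, so only the restriction of f to U matters. *)
Fixpoint Ck_on (R : realType) (W : normedModType R) (V U : set W) (k : nat)
    (f : W -> R) : Prop :=
  {within U, continuous f} /\
  if k is k'.+1 then
    forall v, V v ->
      (forall x, U x -> derivable f x v) /\ Ck_on V U k' ('D_v f)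
  else True.

Definition smooth_on (R : realType) (W : normedModType R) (V U : set W)
    (f : W -> R) : Prop :=
  forall k : nat, Ck_on V U k f.

Definition Sym (R : realType) (n : nat) : set 'M[R]_n := [set X | X^T = X].

Definition SPD (R : realType) (n : nat) : set 'M[R]_n :=
  [set S | Sym S /\ forall v : 'cV[R]_n, v != 0 -> 0 < (v^T *m S *m v) 0 0].

Definition orthogonal_group (R : realType) (n : nat) : set 'M[R]_n :=
  [set P | P *m P^T = 1%:M].

(* [g S X Y] is the value of the tensor field g at the point S of SPD(n) on the
   tangent vectors X, Y in Sym(n); other values of [g] are irrelevant. *)
Definition tensor2 (R : realType) (n : nat) : Type :=
  'M[R]_n -> 'M[R]_n -> 'M[R]_n -> R.

(* Smoothness is that of the components of g in the global chart SPD(n),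
   an open subset of Sym(n). *)
Definition riemannian_metric (R : realType) (n : nat) (g : tensor2 R n) : Prop :=
  [/\ forall S, SPD S -> forall (a : R) X Y Z, Sym X -> Sym Y -> Sym Z ->
        g S (a *: X + Y) Z = a * g S X Z + g S Y Z,
      forall S, SPD S -> forall X Y, Sym X -> Sym Y -> g S X Y = g S Y X,
      forall S, SPD S -> forall X, Sym X -> X != 0 -> 0 < g S X X &
      forall X Y, Sym X -> Sym Y ->
        smooth_on (@Sym R n) (@SPD R n) (fun S => g S X Y)].

Definition orthogonally_invariant (R : realType) (n : nat) (g : tensor2 R n)
    : Prop :=
  forall P S X Y, orthogonal_group P -> SPD S -> Sym X -> Sym Y ->
    g (P *m S *m P^T) (P *m X *m P^T) (P *m Y *m P^T) = g S X Y.

(* [phi] stands for its restriction to (0, oo)^2. *)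
Definition kernel_function (R : realType) (phi : R -> R -> R) : Prop :=
  [/\ forall x y, 0 < x -> 0 < y -> 0 < phi x y,
      forall x y, 0 < x -> 0 < y -> phi x y = phi y x &
      smooth_on (W := (R * R)%type) setT [set p | 0 < p.1 /\ 0 < p.2]
        (fun p => phi p.1 p.2)].

(* g is a kernel metric with kernel function phi. *)
Definition kernel_metric (R : realType) (n : nat) (phi : R -> R -> R)
    (g : tensor2 R n) : Prop :=
  [/\ riemannian_metric g,
      orthogonally_invariant g,
      kernel_function phi &
      forall (S P X X' : 'M[R]_n) (d : 'rV[R]_n),
        SPD S -> orthogonal_group P -> S = P *m diag_mx d *m P^T ->
        Sym X -> X = P *m X' *m P^T ->
        g S X X = \sum_i \sum_j (phi (d 0 i) (d 0 j))^-1 * X' i j ^+ 2].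

(* Covectors are given by functions on all matrices, but only their values on
   Sym(n) matter. *)

(* The tangent vector x' at S such that g_S(x, x') = w(x) for all x; the default
   value 0 is not reached when g is a Riemannian metric and w is linear. *)
Definition metric_dual_vector (R : realType) (n : nat) (g : tensor2 R n)
    (S : 'M[R]_n) (w : 'M[R]_n -> R) : 'M[R]_n :=
  xget 0 [set x' | Sym x' /\ forall x, Sym x -> g S x x' = w x].

Definition cometric (R : realType) (n : nat) (g : tensor2 R n) (S : 'M[R]_n)
    (w w' : 'M[R]_n -> R) : R :=
  w (metric_dual_vector g S w').

Definition frobenius_covector (R : realType) (n : nat) (X : 'M[R]_n)
    : 'M[R]_n -> R :=
  fun Y => \tr (X *m Y).

Definition cometric_as_metric (R : realType) (n : nat) (g : tensor2 R n)
    : tensor2 R n :=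
  fun S X Y => cometric g S (frobenius_covector X) (frobenius_covector Y).

(* Main.v *)
Require Import Defs.
From mathcomp Require Import all_boot all_order all_algebra.
From mathcomp Require Import all_classical all_reals all_analysis.
From mathcomp Require Import ring lra.

(* The cometric at S is the inverse of the Gram matrix of g_S, so by Cramer's rule
   its components are rational functions of those of g with nonvanishing
   denominator, hence smooth; symmetry, positivity and invariance follow from the
   uniqueness of the tangent vector dual to a covector. In the frame of matrices
   conjugated by P, where S = P D P^T, g_S is diagonal with coefficients
   1 / phi(d_i, d_j), hence its inverse is diagonal with coefficients
   phi(d_i, d_j). *)

Set Implicit Arguments.
Unset Strict Implicit.
Unset Printing Implicit Defensive.

Import Order.TTheory GRing.Theory Num.Theory.
Import numFieldNormedType.Exports.

Local Open Scope classical_set_scope.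
Local Open Scope ring_scope.

(** * Algebra of smooth functions *)

(* The derivatives in [Ck_on V U] are taken along lines directed by V, so this is
   all the openness that they require of U. *)
Definition line_open (R : realType) (W : normedModType R) (V U : set W) : Prop :=
  forall x v, U x -> V v -> \forall h \near (0 : R), U (h *: v + x).

Section SmoothFunctions.
Variables (R : realType) (W : normedModType R) (V U : set W).
Hypothesis openU : line_open V U.

(** On the line through [x] directed by [v], all points near [x] lie in [U]. Equating the filters
    rather than their limits transports both [derivable] and [derive]. *)
Lemma eq_on_diff_quotients (f g : W -> R) x v :
  (forall y, U y -> f y = g y) -> U x -> V v ->
  h^-1 *: ((f \o shift x) (h *: v) - f x) @[h --> 0^'] =
  h^-1 *: ((g \o shift x) (h *: v) - g x) @[h --> 0^'].
Proof.
have half (f1 f2 : W -> R) : (forall y, U y -> f1 y = f2 y) -> U x -> V v ->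
  h^-1 *: ((f1 \o shift x) (h *: v) - f1 x) @[h --> 0^'] `=>`
  h^-1 *: ((f2 \o shift x) (h *: v) - f2 x) @[h --> 0^'].
  move=> e Ux Vv; apply: near_eq_cvg.
  apply: nbhs_dnbhs; near=> h.
  rewrite /= !e //.
  by near: h; exact: openU.
move=> e Ux Vv; apply/seteqP; split; apply: half => // y Uy.
by rewrite e.
Unshelve. all: by end_near. Qed.

Lemma Ck_on_eq k (f g : W -> R) :
  (forall y, U y -> f y = g y) -> Ck_on V U k f -> Ck_on V U k g.
Proof.
elim: k f g => [|k IH] f g e [cf Hf]; split => //;
  try by apply: subspace_eq_continuous cf => y; rewrite inE => /e.
move=> v Vv; have [df Hdf] := Hf _ Vv; split => [x Ux|].
  by rewrite /derivable -(eq_on_diff_quotients e) //; exact: df.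
apply: IH Hdf => y Uy.
by rewrite /derive (eq_on_diff_quotients e).
Qed.

Lemma Ck_onW k (f : W -> R) : Ck_on V U k.+1 f -> Ck_on V U k f.
Proof.
elim: k f => [|k IH] f [cf Hf]; split => // v Vv.
by have [df /IH] := Hf _ Vv.
Qed.

Lemma Ck_on_cst k (c : R) : Ck_on V U k (cst c).
Proof.
elim: k c => [|k IH] c; split => //; try by move=> x; exact: cvg_cst.
move=> v _; split => [x _|]; first exact: derivable_cst.
by apply: (Ck_on_eq _ (IH 0)) => y _; rewrite derive_cst.
Qed.

Lemma Ck_onD k (f g : W -> R) :
  Ck_on V U k f -> Ck_on V U k g -> Ck_on V U k (fun x => f x + g x).
Proof.
elim: k f g => [|k IH] f g [cf Hf] [cg Hg]; split => //;
  try by move=> x; apply: cvgD; [exact: cf|exact: cg].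
move=> v Vv; have [df Cf] := Hf _ Vv; have [dg Cg] := Hg _ Vv.
split => [x Ux|]; first by apply: derivableD; [exact: df|exact: dg].
apply: (Ck_on_eq _ (IH _ _ Cf Cg)) => y Uy.
by rewrite -deriveD //; [exact: df|exact: dg].
Qed.

(** Leibniz rule: the derivative involves [f] and [g] themselves, which are lowered by one order
    with [Ck_onW] to meet the induction hypothesis. *)
Lemma Ck_onM k (f g : W -> R) :
  Ck_on V U k f -> Ck_on V U k g -> Ck_on V U k (fun x => f x * g x).
Proof.
elim: k f g => [|k IH] f g Kf Kg; have [cf Hf] := Kf; have [cg Hg] := Kg;
  split => //; try by move=> x; apply: cvgM; [exact: cf|exact: cg].
move=> v Vv; have [df Cf] := Hf _ Vv; have [dg Cg] := Hg _ Vv.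
split => [x Ux|]; first by apply: derivableM; [exact: df|exact: dg].
apply: (Ck_on_eq _ (Ck_onD (IH _ _ (Ck_onW Kf) Cg) (IH _ _ (Ck_onW Kg) Cf))).
move=> y Uy; rewrite -[LHS]/(f y *: 'D_v g y + g y *: 'D_v f y).
by rewrite -deriveM //; [exact: df|exact: dg].
Qed.

(** The derivative of 1/f is -(1/f)^2 f', so regularity of order k of 1/f and of f' yields order k +
    1 for 1/f. *)
Lemma Ck_onV k (f : W -> R) :
  (forall x, U x -> f x != 0) ->
  Ck_on V U k f -> Ck_on V U k (fun x => (f x)^-1).
Proof.
move=> f0; elim: k => [|k IH] Kf; have [cf Hf] := Kf; split => //;
  try by rewrite continuous_subspace_in => x; rewrite inE => Ux;
         apply: cvgV; [exact: f0|exact: cf].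
move=> v Vv; have [df Cf] := Hf _ Vv.
split => [x Ux|]; first by apply: derivableV; [exact: f0|exact: df].
have Ki := IH (Ck_onW Kf).
apply: (Ck_on_eq _ (Ck_onM (Ck_on_cst k (-1)) (Ck_onM (Ck_onM Ki Ki) Cf))).
move=> y Uy; rewrite deriveV; [|exact: f0|exact: df].
by rewrite /cst mulN1r expr2 invfM -mulNr.
Qed.

Lemma Ck_on_sum k (I : Type) (r : seq I) (P : pred I) (F : I -> W -> R) :
  (forall i, Ck_on V U k (F i)) ->
  Ck_on V U k (fun x => \sum_(i <- r | P i) F i x).
Proof.
move=> KF; elim: r => [|i r IH].
  by apply: (Ck_on_eq _ (Ck_on_cst k 0)) => y _; rewrite big_nil.
case Pi: (P i).
  by apply: (Ck_on_eq _ (Ck_onD (KF i) IH)) => y _; rewrite big_cons Pi.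
by apply: (Ck_on_eq _ IH) => y _; rewrite big_cons Pi.
Qed.

Lemma Ck_on_prod k (I : Type) (r : seq I) (P : pred I) (F : I -> W -> R) :
  (forall i, Ck_on V U k (F i)) ->
  Ck_on V U k (fun x => \prod_(i <- r | P i) F i x).
Proof.
move=> KF; elim: r => [|i r IH].
  by apply: (Ck_on_eq _ (Ck_on_cst k 1)) => y _; rewrite big_nil.
case Pi: (P i).
  by apply: (Ck_on_eq _ (Ck_onM (KF i) IH)) => y _; rewrite big_cons Pi.
by apply: (Ck_on_eq _ IH) => y _; rewrite big_cons Pi.
Qed.

Lemma Ck_on_det k n (A : W -> 'M[R]_n) :
  (forall i j, Ck_on V U k (fun x => A x i j)) ->
  Ck_on V U k (fun x => \det (A x)).
Proof.
move=> KA; apply: Ck_on_sum => s.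
by apply: Ck_onM; [exact: Ck_on_cst|apply: Ck_on_prod => i; exact: KA].
Qed.

(** Cramer's rule: on [U] the entry is a cofactor, polynomial in the entries of [A x], divided by a
    nonvanishing determinant. *)
Lemma Ck_on_invmx k n (A : W -> 'M[R]_n) i j :
  (forall x, U x -> A x \in unitmx) ->
  (forall i j, Ck_on V U k (fun x => A x i j)) ->
  Ck_on V U k (fun x => invmx (A x) i j).
Proof.
move=> uA KA.
have Kd : Ck_on V U k (fun x => (\det (A x))^-1).
  apply: Ck_onV; last exact: Ck_on_det.
  by move=> x /uA; rewrite unitmxE unitfE.
have Kc : Ck_on V U k (fun x => cofactor (A x) j i).
  apply: Ck_onM; first exact: Ck_on_cst.
  apply: Ck_on_det => a b.
  by apply: (Ck_on_eq _ (KA (lift j a) (lift i b))) => y _; rewrite !mxE.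
apply: (Ck_on_eq _ (Ck_onM Kd Kc)) => y Uy.
by rewrite /invmx uA // !mxE.
Qed.

End SmoothFunctions.

(** * Openness of SPD(n) *)

Lemma unitmx_lker0 (F : fieldType) (n : nat) (A : 'M[F]_n) :
  (forall u : 'rV_n, u *m A = 0 -> u = 0) -> A \in unitmx.
Proof.
move=> kA; rewrite -row_free_unit -kermx_eq0; apply/rowV0P => u.
by move/sub_kermxP/kA.
Qed.

Lemma SPD_unitmx (R : realType) (n : nat) (S : 'M[R]_n) :
  SPD S -> S \in unitmx.
Proof.
move=> [_ pS]; apply: unitmx_lker0 => u uS; apply/eqP/negP => /negP u0.
have uT0 : u^T != 0 by apply: contra_neq u0 => uT0; rewrite -[u]trmxK uT0 trmx0.
by have := pS _ uT0; rewrite trmxK uS mul0mx mxE ltxx.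
Qed.

(* The Cauchy-Schwarz inequality for the form S, applied to v and S^-1 e_i,
   bounds v_i^2 by a multiple of v^T S v. *)
Lemma SPD_coercive (R : realType) (n : nat) (S : 'M[R]_n) : SPD S ->
  exists2 c : R, 0 <= c &
    forall v : 'cV_n, \sum_i v i 0 ^+ 2 <= c * (v^T *m S *m v) 0 0.
Proof.
move=> SS; have [symS pS] := SS.
have uS := SPD_unitmx SS.
have [w Sw] : exists w : 'I_n -> 'cV[R]_n, forall i, S *m w i = delta_mx i 0.
  by exists (fun i => invmx S *m delta_mx i 0) => i; rewrite mulKVmx.
pose q i := ((w i)^T *m S *m w i) 0 0.
have q0 i : 0 < q i.
  apply: pS; apply/eqP => wi0; have := Sw i; rewrite wi0 mulmx0.
  by move/matrixP/(_ i 0)/eqP; rewrite !mxE !eqxx eq_sym oner_eq0.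
exists (\sum_i q i); first by apply: sumr_ge0 => i _; exact: ltW.
move=> v; rewrite mulr_suml; apply: ler_sum => i _.
(* This [t] minimizes the form S at v - t w_i; the minimum v^T S v - v_i^2 / q_i is nonnegative. *)
pose t := v i 0 / q i.
have vSw : (v^T *m S *m w i) 0 0 = v i 0.
  by rewrite -mulmxA Sw -colE !mxE.
have wSv : ((w i)^T *m S *m v) 0 0 = v i 0.
  have tr11 (M : 'M[R]_1) : M 0 0 = M^T 0 0 by rewrite mxE.
  by rewrite -vSw [LHS]tr11 !trmx_mul trmxK symS mulmxA.
have ge0 (x : 'cV[R]_n) : 0 <= (x^T *m S *m x) 0 0.
  have [->|/pS/ltW//] := eqVneq x 0.
  by rewrite mulmx0 mxE.
have := ge0 (v - t *: w i).
rewrite [_^T]linearB /= [(t *: _)^T]linearZ /= !mulmxBl !mulmxBr -!scalemxAl -!scalemxAr.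
have mxB (A B : 'M[R]_1) : (A - B) 0 0 = A 0 0 - B 0 0 by rewrite !mxE.
have mxZ a (A : 'M[R]_1) : (a *: A) 0 0 = a * A 0 0 by rewrite !mxE.
rewrite !(mxB, mxZ) vSw wSv -/(q i).
have -> : (v^T *m S *m v) 0 0 - t * v i 0 - (t * v i 0 - t * (t * q i)) =
  (v^T *m S *m v) 0 0 - v i 0 ^+ 2 / q i.
  by rewrite /t; field; rewrite gt_eqF.
by rewrite subr_ge0 ler_pdivrMr // mulrC.
Qed.

(** Each |v_i v_j| is at most the sum of squares, since 2 |v_i v_j| <= v_i^2 + v_j^2; the constant
    is thus the sum of the |X_ij|. *)
Lemma quadratic_form_bound (R : realType) (n : nat) (X : 'M[R]_n) :
  exists2 c : R, 0 <= c &
    forall v : 'cV_n, `|(v^T *m X *m v) 0 0| <= c * \sum_i v i 0 ^+ 2.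
Proof.
exists (\sum_i \sum_j `|X j i|).
  by apply: sumr_ge0 => i _; apply: sumr_ge0.
move=> v; set s := \sum_i v i 0 ^+ 2.
have sq k : v k 0 ^+ 2 <= s.
  by rewrite /s (bigD1 k) //= lerDl sumr_ge0 // => l _; exact: sqr_ge0.
rewrite mxE (le_trans (ler_norm_sum _ _ _)) // mulr_suml.
apply: ler_sum => i _; rewrite mxE !mulr_suml.
rewrite (le_trans (ler_norm_sum _ _ _)) //.
apply: ler_sum => j _; rewrite !mxE !normrM.
rewrite [X in X * _]mulrC -mulrA ler_wpM2l //.
have := sq i; have := sq j; rewrite -(real_normK (num_real (v i 0))).
rewrite -(real_normK (num_real (v j 0))).
by have := sqr_ge0 (`|v i 0| - `|v j 0|); nra.
Qed.

(** The two bounds give |v^T X v| <= c' c v^T S v, with constants uniform in v, so for small h the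
    perturbation h X cannot destroy positivity. *)
Lemma SPD_line_open (R : realType) (n : nat) : line_open (@Sym R n) (@SPD R n).
Proof.
move=> S X SS symX; have [symS pS] := SS.
have [c c0 Sc] := SPD_coercive SS.
have [c' c'0 Xc'] := quadratic_form_bound X.
(* The added 1 keeps this radius meaningful when c' c = 0. *)
have e0 : 0 < (c' * c + 1)^-1.
  by rewrite invr_gt0 ltr_wpDl // mulr_ge0.
near=> h; split.
  by rewrite /Sym /= linearD linearZ /= symX symS.
move=> v v0; rewrite mulmxDr mulmxDl -scalemxAr -scalemxAl mxE [X in X + _]mxE.
have hs : `|h| < (c' * c + 1)^-1.
  by near: h; exact: (@nbhs0_lt R R).
have := pS v v0; have := Sc v; have := Xc' v.
set a := (_ *m X *m _) 0 0; set b := (_ *m S *m _) 0 0; set s := \sum_i _.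
move=> Ha Hs Hb.
have : `|h * a| < b.
  rewrite normrM.
  apply: (@le_lt_trans _ _ (`|h| * (c' * c) * b)).
    rewrite -!mulrA ler_wpM2l // (le_trans Ha) //.
    by rewrite ler_wpM2l.
  rewrite gtr_pMl //.
  move: hs; rewrite -[X in _ < X]mul1r ltr_pdivlMr ?mulr_ge0 //; last first.
    by rewrite ltr_wpDl // mulr_ge0.
  by apply: le_lt_trans; rewrite ler_wpM2l // lerDl.
by rewrite ltr_norml => /andP[]; lra.
Unshelve. all: by end_near. Qed.

(** * Duality for inner products on Sym(n) *)

Section Gram.
Variables (R : realFieldType) (N : nat) (b : 'rV[R]_N -> 'rV[R]_N -> R).
Hypothesis b_lin : forall a u v w, b (a *: u + v) w = a * b u w + b v w.
Hypothesis b_sym : forall u v, b u v = b v u.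
Hypothesis b_pos : forall u, u != 0 -> 0 < b u u.

Definition gram := \matrix_(i, j) b (delta_mx 0 i) (delta_mx 0 j).

Lemma gramE u v : b u v = (u *m gram *m v^T) 0 0.
Proof.
have b0 w : b 0 w = 0.
  have := b_lin 1 0 0 w; rewrite scaler0 addr0 mul1r => /eqP.
  by rewrite -subr_eq0 opprD addNKr oppr_eq0 => /eqP.
have b_sum w x : b x w = \sum_i x 0 i * b (delta_mx 0 i) w.
  rewrite [in LHS](row_sum_delta x); elim/big_rec2: _ => [|i y z _ <-].
    exact: b0.
  exact: b_lin.
rewrite b_sum -mulmxA mxE; apply: eq_bigr => i _; congr (_ * _).
rewrite b_sym b_sum mxE; apply: eq_bigr => j _.
by rewrite !mxE mulrC b_sym.
Qed.

Lemma gram_unitmx : gram \in unitmx.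
Proof.
apply: unitmx_lker0 => u uG; apply/eqP/negP => /negP /b_pos.
by rewrite gramE uG mul0mx mxE ltxx.
Qed.

(** Explicit Riesz representation of the linear form u -> u w^T. *)
Lemma gram_solve u w : b u (w *m invmx gram) = (u *m w^T) 0 0.
Proof.
have Gs : gram^T = gram by apply/matrixP => i j; rewrite !mxE.
rewrite gramE trmx_mul trmx_inv Gs mulmxA -(mulmxA u).
by rewrite mulmxV ?gram_unitmx // mulmx1.
Qed.

End Gram.

(** * The Frobenius inner product *)

Lemma mxtrace_trmul (R : comNzRingType) (n : nat) (A B : 'M[R]_n) :
  \tr (A^T *m B) = \sum_i \sum_j A i j * B i j.
Proof.
rewrite exchange_big; apply: eq_bigr => i _; rewrite mxE.
by apply: eq_bigr => j _; rewrite mxE.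
Qed.

Lemma mxtrace_trmul_ge0 (R : realFieldType) (n : nat) (A : 'M[R]_n) :
  0 <= \tr (A^T *m A).
Proof.
by rewrite mxtrace_trmul; do 2!apply: sumr_ge0 => ? _; rewrite -expr2 sqr_ge0.
Qed.

Lemma mxtrace_trmul_eq0 (R : realFieldType) (n : nat) (A : 'M[R]_n) :
  \tr (A^T *m A) = 0 -> A = 0.
Proof.
rewrite mxtrace_trmul => /eqP; rewrite psumr_eq0 => [/allP A0|i _]; last first.
  by apply: sumr_ge0 => ? _; rewrite -expr2 sqr_ge0.
apply/matrixP => i j; rewrite mxE.
have := A0 i (mem_index_enum _); rewrite psumr_eq0 => [/allP Ai0|k _]; last first.
  by rewrite -expr2 sqr_ge0.
have := Ai0 j (mem_index_enum _).
by rewrite /= mulf_eq0 orbb => /eqP.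
Qed.

(* Only the values on Sym(n) of the form b matter: it is extended to all matrices
   by the Frobenius product of the skew-symmetric parts, so that the standard
   basis of the space of matrices can be used. *)
Section SymDual.
Variables (R : realType) (n : nat).

Definition sym_part (A : 'M[R]_n) : 'M[R]_n := 2^-1 *: (A + A^T).
Definition skew_part (A : 'M[R]_n) : 'M[R]_n := 2^-1 *: (A - A^T).

Lemma sym_partP A : Sym (sym_part A).
Proof. by rewrite /Sym /= linearZ linearD /= trmxK addrC. Qed.

Lemma sym_part_lin a A B :
  sym_part (a *: A + B) = a *: sym_part A + sym_part B.
Proof. by apply/matrixP => i j; rewrite !mxE; ring. Qed.

Lemma skew_part_lin a A B :
  skew_part (a *: A + B) = a *: skew_part A + skew_part B.
Proof. by apply/matrixP => i j; rewrite !mxE; ring. Qed.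

Lemma sym_skew_part A : sym_part A + skew_part A = A.
Proof. by apply/matrixP => i j; rewrite !mxE; field. Qed.

Lemma sym_part_skew A : sym_part (skew_part A) = 0.
Proof. by apply/matrixP => i j; rewrite !mxE; ring. Qed.

Lemma skew_part_skew A : skew_part (skew_part A) = skew_part A.
Proof. by apply/matrixP => i j; rewrite !mxE; field. Qed.

Lemma sym_part_id A : Sym A -> sym_part A = A.
Proof.
by move=> symA; apply/matrixP => i j; rewrite /sym_part symA !mxE; field.
Qed.

Lemma skew_part_sym A : Sym A -> skew_part A = 0.
Proof. by move=> symA; rewrite /skew_part symA subrr scaler0. Qed.

(** Transposing inside the trace and cyclicity show that [A] and its transpose have the same
    Frobenius product with [Y]. *)
Lemma mxtrace_skew_sym A Y : Sym Y -> \tr ((skew_part A)^T *m Y) = 0.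
Proof.
move=> symY; rewrite linearZ linearB /= trmxK -scalemxAl linearZ mulmxBl /=.
rewrite linearB /= -[\tr (A^T *m Y)]mxtrace_tr trmx_mul trmxK symY.
by rewrite mxtrace_mulC subrr mulr0.
Qed.

Variable b : 'M[R]_n -> 'M[R]_n -> R.

Definition ext_form (u v : 'rV[R]_(n * n)) : R :=
  b (sym_part (vec_mx u)) (sym_part (vec_mx v)) +
  \tr ((skew_part (vec_mx u))^T *m skew_part (vec_mx v)).

(** The [b]-dual of the Frobenius covector of [Y], given by a formula from which smooth dependence
    on [b] can be read, unlike the choice made by [xget]. *)
Definition sym_dual (Y : 'M[R]_n) : 'M[R]_n :=
  vec_mx (mxvec Y *m invmx (gram ext_form)).

Hypothesis b_lin : forall a X Y Z, Sym X -> Sym Y -> Sym Z ->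
  b (a *: X + Y) Z = a * b X Z + b Y Z.
Hypothesis b_sym : forall X Y, Sym X -> Sym Y -> b X Y = b Y X.
Hypothesis b_pos : forall X, Sym X -> X != 0 -> 0 < b X X.

Lemma sym_form0 Z : Sym Z -> b 0 Z = 0.
Proof.
move=> symZ; have sym0 : Sym (0 : 'M[R]_n) by rewrite /Sym /= trmx0.
have := b_lin 1 sym0 sym0 symZ; rewrite scaler0 addr0 mul1r => /eqP.
by rewrite -subr_eq0 opprD addNKr oppr_eq0 => /eqP.
Qed.

Lemma ext_form_lin a u v w :
  ext_form (a *: u + v) w = a * ext_form u w + ext_form v w.
Proof.
rewrite /ext_form linearP sym_part_lin skew_part_lin b_lin; try exact: sym_partP.
by rewrite linearP mulmxDl -scalemxAl linearP /=; ring.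
Qed.

Lemma ext_form_sym u v : ext_form u v = ext_form v u.
Proof.
rewrite /ext_form b_sym; try exact: sym_partP.
by congr (_ + _); rewrite -mxtrace_tr trmx_mul trmxK.
Qed.

(** Either the symmetric part is nonzero and [b] is positive on it, or [u] is purely skew and its
    Frobenius norm is positive. *)
Lemma ext_form_pos u : u != 0 -> 0 < ext_form u u.
Proof.
move=> u0; rewrite /ext_form.
have [s0|s0] := eqVneq (sym_part (vec_mx u)) 0; last first.
  by rewrite ltr_wpDr ?mxtrace_trmul_ge0 // b_pos //; exact: sym_partP.
rewrite s0 sym_form0 ?add0r; last by rewrite /Sym /= trmx0.
rewrite lt_neqAle mxtrace_trmul_ge0 andbT eq_sym.
apply: contra_neq u0 => /mxtrace_trmul_eq0 k0.
apply: (can_inj vec_mxK).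
by rewrite -[LHS]sym_skew_part s0 k0 addr0 linear0.
Qed.

Lemma ext_form_unitmx : gram ext_form \in unitmx.
Proof.
exact: gram_unitmx ext_form_lin ext_form_sym ext_form_pos.
Qed.

(** The vector [sym_dual Y] represents [Y] for the extended form. Testing it against its own skew
    part, which is Frobenius-orthogonal to [Y], shows that this part vanishes; on symmetric matrices
    only [b] then remains. *)
Lemma sym_dualP Y : Sym Y ->
  Sym (sym_dual Y) /\
  forall A, Sym A -> b A (sym_dual Y) = \tr (Y *m A).
Proof.
move=> symY.
have extD A : ext_form (mxvec A) (mxvec (sym_dual Y)) = \tr (A^T *m Y).
  rewrite /sym_dual vec_mxK.
  rewrite (gram_solve ext_form_lin ext_form_sym ext_form_pos).
  rewrite mxtrace_trmul mxE (reindex _ (curry_mxvec_bij n n)) /=.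
  rewrite [RHS]pair_big /=.
  by apply: eq_bigr => -[i j] _; rewrite mxE /= !mxvecE.
have k0 : skew_part (sym_dual Y) = 0.
  apply: mxtrace_trmul_eq0.
  have := extD (skew_part (sym_dual Y)).
  rewrite mxtrace_skew_sym // /ext_form !mxvecK sym_part_skew skew_part_skew.
  by rewrite sym_form0 ?add0r //; exact: sym_partP.
have symD : Sym (sym_dual Y).
  by rewrite -[sym_dual Y]sym_skew_part k0 addr0; exact: sym_partP.
split => // A symA; have := extD A.
rewrite /ext_form !mxvecK !sym_part_id // skew_part_sym // k0 mulmx0 linear0.
by rewrite addr0 symA mxtrace_mulC.
Qed.

Lemma sym_form_inj D E : Sym D -> Sym E ->
  (forall A, Sym A -> b A D = b A E) -> D = E.
Proof.
move=> symD symE DE; apply/eqP/negPn/negP; rewrite -subr_eq0 => n0.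
have b0 F : Sym F -> b (D - E) F = 0.
  (* The difference is rewritten as [-1 *: E + D] to fit the form of [b_lin]. *)
  move=> symF; rewrite addrC -scaleN1r b_lin // mulN1r.
  by rewrite (b_sym symE) // (b_sym symD) // DE // addNr.
have symDE : Sym (D - E) by rewrite /Sym /= linearB /= symD symE.
by have := b_pos symDE n0; rewrite b0 // ltxx.
Qed.

End SymDual.

(** * The cometric *)

Lemma line_open_quadrant (R : realType) :
  line_open (W := (R * R)%type) setT [set p | 0 < p.1 /\ 0 < p.2].
Proof.
have pos_near (a b : R) : 0 < b -> \forall h \near (0 : R), 0 < h * a + b.
  move=> b0; apply: (@cvgr_gt _ _ (nbhs (0 : R)) _ _ (0 * a + b)).
    apply: cvgD; last exact: cvg_cst.
    by apply: cvgM; [exact: cvg_id|exact: cvg_cst].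
  by rewrite mul0r add0r.
by move=> x v [x1 x2] _; near=> h; split; near: h; apply: pos_near.
Unshelve. all: by end_near. Qed.

Lemma kernel_functionV (R : realType) (phi : R -> R -> R) :
  kernel_function phi -> kernel_function (fun x y => (phi x y)^-1).
Proof.
move=> [phi_pos phi_sym phi_smooth]; split.
- by move=> x y x0 y0; rewrite invr_gt0 phi_pos.
- by move=> x y x0 y0; rewrite phi_sym.
- move=> k; apply: (Ck_onV (@line_open_quadrant R)); last exact: phi_smooth.
  by move=> [x y] [/= x0 y0]; rewrite gt_eqF ?phi_pos.
Qed.

(** * Conjugation by orthogonal matrices *)

Lemma orthogonal_groupT (R : realType) (n : nat) (P : 'M[R]_n) :
  orthogonal_group P -> P^T *m P = 1%:M.
Proof. exact: mulmx1C. Qed.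

Lemma Sym_conj (R : realType) (n : nat) (P X : 'M[R]_n) :
  Sym X -> Sym (P *m X *m P^T).
Proof. by move=> symX; rewrite /Sym /= !trmx_mul trmxK symX mulmxA. Qed.

Lemma SPD_conj (R : realType) (n : nat) (P S : 'M[R]_n) :
  orthogonal_group P -> SPD S -> SPD (P *m S *m P^T).
Proof.
move=> oP [symS pS]; split; first exact: Sym_conj.
move=> v v0; have Pv0 : P^T *m v != 0.
  by apply: contra_neq v0 => Pv; rewrite -[v]mul1mx -oP -mulmxA Pv mulmx0.
by have := pS _ Pv0; rewrite trmx_mul trmxK !mulmxA.
Qed.

Lemma conjmx_conjTK (R : realType) (n : nat) (P X : 'M[R]_n) :
  orthogonal_group P -> P *m (P^T *m X *m P) *m P^T = X.
Proof.
by move=> oP; rewrite !mulmxA oP mul1mx -mulmxA oP mulmx1.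
Qed.

Lemma conjTmx_conjK (R : realType) (n : nat) (P X : 'M[R]_n) :
  orthogonal_group P -> P^T *m (P *m X *m P^T) *m P = X.
Proof.
move=> oP; rewrite !mulmxA (orthogonal_groupT oP) mul1mx -mulmxA.
by rewrite (orthogonal_groupT oP) mulmx1.
Qed.

Lemma mxtrace_conj (R : realType) (n : nat) (P X Y : 'M[R]_n) :
  orthogonal_group P ->
  \tr (P *m X *m P^T *m (P *m Y *m P^T)) = \tr (X *m Y).
Proof.
move=> oP; rewrite !mulmxA -(mulmxA _ P^T P) (orthogonal_groupT oP) mulmx1.
by rewrite [LHS]mxtrace_mulC !mulmxA (orthogonal_groupT oP) mul1mx.
Qed.

(** Evaluating the form P^T S P at the i-th basis vector gives d_i. This places the eigenvalues in
    the domain where the kernel function is controlled. *)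
Lemma SPD_diag_gt0 (R : realType) (n : nat) (P : 'M[R]_n) (d : 'rV_n) i :
  orthogonal_group P -> SPD (P *m diag_mx d *m P^T) -> 0 < d 0 i.
Proof.
move=> oP SS; have oPT : orthogonal_group P^T.
  by rewrite /orthogonal_group /= trmxK orthogonal_groupT.
have [_ pD] := SPD_conj oPT SS.
have : (delta_mx i 0 : 'cV[R]_n) != 0.
  apply/eqP => /matrixP/(_ i 0)/eqP.
  by rewrite !mxE !eqxx oner_eq0.
move/pD; rewrite trmxK (conjTmx_conjK _ oP) trmx_delta -rowE -colE !mxE.
by rewrite eqxx mulr1n.
Qed.

Section Cometric.
Variables (R : realType) (n : nat) (g : tensor2 R n).
Hypothesis rg : riemannian_metric g.

Section AtPoint.
Variable S : 'M[R]_n.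
Hypothesis SS : SPD S.

Let g_lin a X Y Z : Sym X -> Sym Y -> Sym Z ->
  g S (a *: X + Y) Z = a * g S X Z + g S Y Z.
Proof. by move=> *; have [H _ _ _] := rg; exact: H. Qed.

Let g_sym X Y : Sym X -> Sym Y -> g S X Y = g S Y X.
Proof. by move=> *; have [_ H _ _] := rg; exact: H. Qed.

Let g_pos X : Sym X -> X != 0 -> 0 < g S X X.
Proof. by move=> *; have [_ _ H _] := rg; exact: H. Qed.

Lemma sym_dual_metric Y : Sym Y ->
  Sym (sym_dual (g S) Y) /\
  forall A, Sym A -> g S A (sym_dual (g S) Y) = \tr (Y *m A).
Proof. exact: sym_dualP. Qed.

Lemma Sym_sym_dual Y : Sym Y -> Sym (sym_dual (g S) Y).
Proof. by case/sym_dual_metric. Qed.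

(** By nondegeneracy of [g S], the vector chosen by [xget] is [D]. Any explicit solution [D] of the
    duality equation therefore computes the cometric. *)
Lemma cometricE X Y D :
  Sym D -> (forall A, Sym A -> g S A D = \tr (Y *m A)) ->
  cometric_as_metric g S X Y = \tr (X *m D).
Proof.
move=> symD gD; rewrite /cometric_as_metric /cometric /metric_dual_vector.
congr (\tr (_ *m _)); apply: xget_unique => // E [symE gE].
apply: (sym_form_inj g_lin g_sym g_pos) => // A symA.
by rewrite gE // gD.
Qed.

Lemma cometric_sym_dual X Y : Sym Y ->
  cometric_as_metric g S X Y = \tr (X *m sym_dual (g S) Y).
Proof.
by move=> symY; have [symD gD] := sym_dual_metric symY; exact: cometricE.
Qed.

(** The cometric is the pullback of [g S] by the duality map, from which it inherits symmetry and
    positivity. *)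
Lemma cometric_dual_dual X Y : Sym X -> Sym Y ->
  cometric_as_metric g S X Y = g S (sym_dual (g S) X) (sym_dual (g S) Y).
Proof.
move=> symX symY; rewrite cometric_sym_dual //.
have [symDX gDX] := sym_dual_metric symX.
have [symDY gDY] := sym_dual_metric symY.
by rewrite g_sym // gDX.
Qed.

Lemma sym_dual_eq0 X : Sym X -> sym_dual (g S) X = 0 -> X = 0.
Proof.
move=> symX DX0; have [_ gDX] := sym_dual_metric symX.
apply: mxtrace_trmul_eq0; rewrite symX -gDX // DX0 g_sym ?(sym_form0 g_lin) //.
by rewrite /Sym /= trmx0.
Qed.

Lemma gram_sym_unitmx : gram (ext_form (g S)) \in unitmx.
Proof. exact: ext_form_unitmx. Qed.

End AtPoint.

Lemma riemannian_metric_cometric : riemannian_metric (cometric_as_metric g).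
Proof.
have [g_lin g_sym g_pos g_smooth] := rg; split.
- move=> S SS a X Y Z _ _ symZ.
  by rewrite !(cometric_sym_dual SS) // mulmxDl -scalemxAl linearP.
- move=> S SS X Y symX symY.
  rewrite !(cometric_dual_dual SS) // g_sym //.
  + exact: Sym_sym_dual.
  + exact: Sym_sym_dual.
- move=> S SS X symX X0; rewrite (cometric_dual_dual SS) //; apply: g_pos => //.
    exact: Sym_sym_dual.
  by apply: contra_neq X0; exact: sym_dual_eq0.
- move=> X Y symX symY k.
  have op := @SPD_line_open R n.
  (* A Gram entry is a component of g on two fixed symmetric matrices plus a skew term independent
     of S. *)
  have KG i j : Ck_on (@Sym R n) (@SPD R n) k
      (fun S => gram (ext_form (g S)) i j).
    pose A i : 'M[R]_n := vec_mx (delta_mx 0 i).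
    have Kg := g_smooth _ _ (sym_partP (A i)) (sym_partP (A j)) k.
    have Kc := Ck_on_cst op k (\tr ((skew_part (A i))^T *m skew_part (A j))).
    by apply: (Ck_on_eq op _ (Ck_onD op Kg Kc)) => S _; rewrite mxE.
  (* Each entry of the dual is a combination of entries of the inverse Gram matrix, with the
     constant coordinates of [Y] as coefficients. *)
  have KD i j : Ck_on (@Sym R n) (@SPD R n) k (fun S => sym_dual (g S) Y i j).
    have KE l := Ck_onM op (Ck_on_cst op k (mxvec Y 0 l))
      (Ck_on_invmx op l (mxvec_index i j) gram_sym_unitmx KG).
    apply: (Ck_on_eq op _ (Ck_on_sum op (index_enum _) xpredT KE)) => S _.
    by rewrite [RHS]mxE [RHS]mxE.
  have KX i j := Ck_onM op (Ck_on_cst op k (X i j)) (KD j i).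
  have KS i := Ck_on_sum op (index_enum _) xpredT (KX i).
  apply: (Ck_on_eq op _ (Ck_on_sum op (index_enum _) xpredT KS)) => S SS.
  rewrite (cometric_sym_dual SS) //.
  by apply: eq_bigr => i _; rewrite mxE.
Qed.

(** Invariance of g and of the Frobenius product makes duality equivariant: the dual of P Y P^T at P
    S P^T is the conjugate by P of the dual of Y at S. *)
Lemma orthogonally_invariant_cometric :
  orthogonally_invariant g -> orthogonally_invariant (cometric_as_metric g).
Proof.
move=> g_inv P S X Y oP SS symX symY.
have [symD gD] := sym_dual_metric SS symY.
rewrite (cometric_sym_dual SS) //.
rewrite (@cometricE _ (SPD_conj oP SS) _ _ (P *m sym_dual (g S) Y *m P^T)).
- exact: mxtrace_conj.
- exact: Sym_conj.
move=> A symA; rewrite -(conjmx_conjTK A oP).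
have symA' : Sym (P^T *m A *m P) by have := Sym_conj P^T symA; rewrite trmxK.
by rewrite g_inv // gD // mxtrace_conj.
Qed.

End Cometric.

(* By polarization, g_S is diagonal in the basis of matrices conjugate by P; hence
   the tangent vector dual to X = P X' P^T has entries phi(d_i, d_j) X'_ij. *)
Lemma cometric_kernel (R : realType) (n : nat) (phi : R -> R -> R)
    (g : tensor2 R n) (S P X X' : 'M[R]_n) (d : 'rV[R]_n) :
  kernel_metric phi g ->
  SPD S -> orthogonal_group P -> S = P *m diag_mx d *m P^T ->
  Sym X -> X = P *m X' *m P^T ->
  cometric_as_metric g S X X = \sum_i \sum_j phi (d 0 i) (d 0 j) * X' i j ^+ 2.
Proof.
move=> [rg _ [phi_pos phi_sym _] g_phi] SS oP defS symX defX.
have [g_lin g_sym _ _] := rg.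
have d0 i : 0 < d 0 i by apply: (@SPD_diag_gt0 _ _ P); rewrite -?defS.
have symX' : Sym X'.
  rewrite -(conjTmx_conjK X' oP) -defX.
  by have := Sym_conj P^T symX; rewrite trmxK.
pose D' := \matrix_(i, j) (phi (d 0 i) (d 0 j) * X' i j).
have symD' : Sym D'.
  by apply/matrixP => i j; rewrite !mxE phi_sym // -{1}symX' mxE.
have symD := Sym_conj P symD'.
rewrite (@cometricE _ _ _ rg _ SS _ _ (P *m D' *m P^T)) //.
  rewrite {1}defX mxtrace_conj // -{1}symX' mxtrace_trmul.
  by apply: eq_bigr => i _; apply: eq_bigr => j _; rewrite !mxE; ring.
move=> A symA; pose A' := P^T *m A *m P.
have defA : A = P *m A' *m P^T by rewrite conjmx_conjTK.
have symAD : Sym (A + P *m D' *m P^T) by rewrite /Sym /= linearD /= symA symD.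
have gAD := g_lin S SS 1 A (P *m D' *m P^T) _ symA symD symAD.
have gA := g_lin S SS 1 A (P *m D' *m P^T) _ symA symD symA.
have gD := g_lin S SS 1 A (P *m D' *m P^T) _ symA symD symD.
rewrite scale1r !mul1r in gAD gA gD.
have eAD := g_phi S P _ (A' + D') d SS oP defS symAD.
have eA := g_phi S P _ A' d SS oP defS symA defA.
have eD := g_phi S P _ D' d SS oP defS symD erefl.
(* The kernel formula only gives values g(Z, Z), so the mixed term is obtained by expanding the
   square. *)
have polar : g S (A + P *m D' *m P^T) (A + P *m D' *m P^T) =
  g S A A + g S (P *m D' *m P^T) (P *m D' *m P^T) + 2 * g S A (P *m D' *m P^T).
  rewrite gAD (g_sym S SS A) // (g_sym S SS (P *m D' *m P^T) (_ + _)) //.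
  by rewrite gA gD (g_sym S SS (P *m D' *m P^T) A) //; ring.
rewrite eAD in polar; last by rewrite mulmxDr mulmxDl -defA.
rewrite eA eD in polar.
have trXA : \tr (X *m A) = \sum_i \sum_j X' i j * A' i j.
  by rewrite defX defA mxtrace_conj // -{1}symX' mxtrace_trmul.
rewrite trXA; apply: (@mulfI _ 2) => //.
have -> : 2 * g S A (P *m D' *m P^T) =
  \sum_i \sum_j (phi (d 0 i) (d 0 j))^-1 * (A' + D') i j ^+ 2 -
  \sum_i \sum_j (phi (d 0 i) (d 0 j))^-1 * A' i j ^+ 2 -
  \sum_i \sum_j (phi (d 0 i) (d 0 j))^-1 * D' i j ^+ 2.
  by rewrite polar; ring.
(* Entrywise, ((A' + D')^2 - A'^2 - D'^2) / phi = 2 A' D' / phi = 2 X' A', because D' = phi X'. *)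
rewrite -!sumrB mulr_sumr; apply: eq_bigr => i _.
rewrite -!sumrB mulr_sumr; apply: eq_bigr => j _.
rewrite [(A' + D') i j]mxE [D' i j]mxE.
by field; rewrite gt_eqF ?phi_pos.
Qed.

Theorem proposition4p2 (R : realType) (n : nat) (phi : R -> R -> R)
    (g : tensor2 R n) (hg : kernel_metric phi g) :
  kernel_metric (fun x y : R => (phi x y)^-1) (cometric_as_metric g).
Proof.
have [rg g_inv k_phi _] := hg; split.
- exact: riemannian_metric_cometric.
- exact: orthogonally_invariant_cometric.
- exact: kernel_functionV.
- move=> S P X X' d SS oP defS symX defX.
  rewrite (cometric_kernel hg SS oP defS symX defX).
  by apply: eq_bigr => i _; apply: eq_bigr => j _; rewrite invrK.
Qed.
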